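(* Let $N\ge 1$, let $A_1,\ldots,A_N\in M_2(\mathbb{R})$, and let $s,t$ be real numbers with $0<t\le 1$ and $t\le s\le 2t$. Suppose that for some integer $k\in\{0,\ldots,N\}$ we have $$A_i=\begin{pmatrix}a_i&0\\0&d_i\end{pmatrix}\text{ when }1\le i\le k,\qquad A_i=\begin{pmatrix}0&b_i\\c_i&0\end{pmatrix}\text{ when }k+1\le i\le N,$$ where each $a_i,b_i,c_i,d_i$ is a nonzero real number. Then the limit $$\lim_{n\to\infty}\left(\sum_{i_1,\ldots,i_n=1}^N\alpha_1(A_{i_n}\cdots A_{i_1})^t\,\alpha_2(A_{i_n}\cdots A_{i_1})^{s-t}\right)^{\frac1n}$$ is equal to the spectral radius $$\rho\left(\begin{pmatrix}\sum_{i=1}^k|a_i|^t|d_i|^{s-t}&\sum_{i=k+1}^N|b_i|^t|c_i|^{s-t}\\ \sum_{i=k+1}^N|b_i|^{s-t}|c_i|^t&\sum_{i=1}^k|a_i|^{s-t}|d_i|^t\end{pmatrix}\right).$$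
   Context: $M_2(\mathbb{R})$ denotes the space of $2\times 2$ real matrices and $\rho(B)$ the spectral radius of a matrix $B$. The singular values $\alpha_1(A)\ge\alpha_2(A)\ge 0$ of $A\in M_2(\mathbb{R})$ are the non-negative square roots of the eigenvalues of $A^TA$, listed in decreasing order with multiplicity. Empty sums equal $0$. *)

(* Defs.v *)
From HB Require Import structures.
From mathcomp Require Import all_boot all_order all_algebra.
From mathcomp Require Import polyrcf complex.
From mathcomp Require Import all_classical all_reals all_analysis.
Import Order.TTheory GRing.Theory Num.Theory.
Import numFieldNormedType.Exports.

Set Implicit Arguments.
Unset Strict Implicit.
Unset Printing Implicit Defensive.

Local Open Scope ring_scope.
Local Open Scope classical_set_scope.

Definition mx22 (R : Type) (a b c d : R) : 'M[R]_2 :=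
  \matrix_(i < 2, j < 2)
    if i == ord0 then (if j == ord0 then a else b)
    else (if j == ord0 then c else d).

(* [rootsR] is increasing and duplicate-free; multiplicities are algebraic.
   Non-real eigenvalues are not listed. *)
Definition real_eigenvalues (R : rcfType) (n : nat) (B : 'M[R]_n) : seq R :=
  flatten [seq nseq (mup x (char_poly B)) x | x <- rootsR (char_poly B)].

(* All eigenvalues of the positive semidefinite matrix A^T A are real and
   nonnegative, so nothing is lost by [real_eigenvalues] and [Num.sqrt]. *)
Definition singular_values (R : rcfType) (n : nat) (A : 'M[R]_n) : seq R :=
  [seq Num.sqrt x | x <- rev (real_eigenvalues (A^T *m A))].

Definition alpha1 (R : rcfType) (A : 'M[R]_2) : R := (singular_values A)`_0.
Definition alpha2 (R : rcfType) (A : 'M[R]_2) : R := (singular_values A)`_1.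

(* For n > 0 the set is finite and nonempty, so [sup] is a maximum. *)
Definition spectral_radius (R : realType) (n : nat) (B : 'M[R]_n) : R :=
  sup [set r : R | exists2 z : R[i],
         eigenvalue (map_mx (real_complex R) B) z & r = Normc.normc z].

(* With letters indexed from 0, this is A_{w_(n-1)} *m ... *m A_{w_0}: later
   letters multiply on the left. *)
Definition word_prod (R : nzRingType) (N n : nat) (A : 'I_N -> 'M[R]_2)
    (w : {ffun 'I_n -> 'I_N}) : 'M[R]_2 :=
  \prod_(j < n) A (w (rev_ord j)).

(* Main.v *)
(* Write p = s - t, so that 0 <= p <= t.  On matrices that are diagonal or
   antidiagonal with nonzero entries x, y, the map sending B to the matrix of the
   same shape with entries |x|^t |y|^p and |x|^p |y|^t is multiplicative, and
   alpha1(B)^t alpha2(B)^p, being the larger of these two entries, lies between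
   half their sum and their sum.  Summing over words of length n, the quantity
   under the n-th root is comparable, up to a factor 2, to the sum of the entries
   of M^n, where M is the 2x2 matrix of the statement.  If M has positive
   off-diagonal entries, a positive eigenvector shows that this entry sum is
   comparable to rho(M)^n; otherwise M is diagonal and this is immediate. *)

Require Import Defs.
From HB Require Import structures.
From mathcomp Require Import all_boot all_order all_algebra.
From mathcomp Require Import polyrcf complex.
From mathcomp Require Import all_classical all_reals all_analysis.
From mathcomp Require Import ring lra.
Import Order.TTheory GRing.Theory Num.Theory.
Import numFieldNormedType.Exports.
Local Open Scope ring_scope.
Local Open Scope classical_set_scope.

(** * Entrywise calculus of 2x2 matrices *)

Lemma ord2P (i : 'I_2) : i = 0 \/ i = 1.
Proof.
by case: i => [[|[|//]] p]; [left | right]; apply/val_inj.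
Qed.

Lemma mx22_eta (R : Type) (A : 'M[R]_2) :
  A = mx22 (A 0 0) (A 0 1) (A 1 0) (A 1 1).
Proof.
apply/matrixP => i j; rewrite mxE.
by case: (ord2P i) => ->; case: (ord2P j) => ->.
Qed.

Lemma mulmx22 (R : pzRingType) (a b c d a' b' c' d' : R) :
  mx22 a b c d *m mx22 a' b' c' d' =
  mx22 (a * a' + b * c') (a * b' + b * d')
       (c * a' + d * c') (c * b' + d * d').
Proof.
apply/matrixP => i j; rewrite !mxE big_ord_recl big_ord1 !mxE.
by case: (ord2P i) => ->; case: (ord2P j) => ->.
Qed.

Lemma mx22_sum (R : pzRingType) (I : finType) (P : pred I)
    (a b c d : I -> R) :
  \sum_(i | P i) mx22 (a i) (b i) (c i) (d i) =
  mx22 (\sum_(i | P i) a i) (\sum_(i | P i) b i)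
       (\sum_(i | P i) c i) (\sum_(i | P i) d i).
Proof.
apply/matrixP => i j; rewrite summxE mxE.
by case: (ord2P i) => ->; case: (ord2P j) => -> /=; apply: eq_bigr => x _;
  rewrite mxE.
Qed.

Lemma trmx22 (R : Type) (a b c d : R) : (mx22 a b c d)^T = mx22 a c b d.
Proof.
apply/matrixP => i j; rewrite !mxE.
by case: (ord2P i) => ->; case: (ord2P j) => ->.
Qed.

Lemma char_poly_mx22 (R : comNzRingType) (a b c d : R) :
  char_poly (mx22 a b c d) =
  ('X - a%:P) * ('X - d%:P) - b%:P * c%:P.
Proof.
rewrite /char_poly (expand_det_row _ 0) big_ord_recl big_ord1 /cofactor.
rewrite !det_mx11 !mxE /= !mulr1n !mulr0n; ring.
Qed.

(** * Eigenvalues, singular values and spectral radius from a split characteristic polynomial *)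

Lemma real_eigenvalues_split (R : rcfType) (B : 'M[R]_2) (u v : R) :
  u <= v -> char_poly B = ('X - u%:P) * ('X - v%:P) ->
  real_eigenvalues B = [:: u; v].
Proof.
move=> uv; rewrite /real_eigenvalues => ->; set p := _ * _.
have pE : p = \prod_(x <- [:: u; v]) ('X - x%:P) by rewrite !big_cons big_nil mulr1.
have p0 : p != 0 by rewrite mulf_neq0 ?polyXsubC_eq0.
have mupE x : mup x p = ((u == x) + (v == x))%N.
  by rewrite pE mu_prod_XsubC /= addn0.
have rootsE : rootsR p =i [:: u; v].
  move=> x; rewrite -(roots_on_rootsR p0) /= /p rootM !root_XsubC.
  by rewrite !inE.
have srt : sorted <%O (rootsR p) by exact: sorted_roots.
(* If [u = v], the duplicate-free root list has one entry, and its multiplicity 2 supplies the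
   second copy. *)
move: uv; rewrite le_eqVlt => /predU1P[uv|uv].
- have -> : rootsR p = [:: u].
    by apply: lt_sorted_eq => // x; rewrite rootsE -uv !inE orbb.
  by rewrite /= mupE -uv eqxx.
- have -> : rootsR p = [:: u; v].
    by apply: lt_sorted_eq => //=; rewrite uv.
  by rewrite /= !mupE !eqxx (lt_eqF uv) (gt_eqF uv).
Qed.

(** Only the Gram matrix enters, so this serves diagonal and antidiagonal [A] alike. *)
Lemma singular_values_diag_gram (R : rcfType) (A : 'M[R]_2) (x y : R) :
  A^T *m A = mx22 (x ^+ 2) 0 0 (y ^+ 2) ->
  singular_values A = [:: Num.max `|x| `|y|; Num.min `|x| `|y|].
Proof.
move=> gramE; have cpE : char_poly (A^T *m A) =
    ('X - (x ^+ 2)%:P) * ('X - (y ^+ 2)%:P).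
  by rewrite gramE char_poly_mx22 mul0r subr0.
rewrite /singular_values; have [xy|/ltW yx] := lerP `|x| `|y|.
- rewrite (@real_eigenvalues_split _ _ _ _ _ cpE) /=; last first.
    by rewrite -(real_normK (num_real x)) -(real_normK (num_real y)) lerXn2r ?nnegrE.
  by rewrite !sqrtr_sqr.
- rewrite mulrC in cpE; rewrite (@real_eigenvalues_split _ _ _ _ _ cpE) /=.
    by rewrite !sqrtr_sqr.
  by rewrite -(real_normK (num_real x)) -(real_normK (num_real y)) lerXn2r ?nnegrE.
Qed.

Lemma spectral_radius_split (R : realType) (B : 'M[R]_2) (u v : R) :
  char_poly B = ('X - u%:P) * ('X - v%:P) -> `|v| <= u ->
  spectral_radius B = u.
Proof.
move=> cpE vu; have u0 : 0 <= u by apply: le_trans vu.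
have normcR (x : R) : Normc.normc (real_complex R x) = `|x|.
  by rewrite /= expr0n addr0 sqrtr_sqr.
(* The characteristic polynomial already splits over the reals, so passing to complex scalars adds
   no eigenvalue. *)
have eigE z : eigenvalue (map_mx (real_complex R) B) z =
    (z == real_complex R u) || (z == real_complex R v).
  rewrite eigenvalue_root_char -map_char_poly cpE rmorphM !rmorphB /=.
  by rewrite !map_polyX !map_polyC rootM !root_XsubC.
rewrite /spectral_radius; set E := [set r | _].
have Eu : E u.
  by exists (real_complex R u); rewrite ?normcR ?ger0_norm // eigE eqxx.
have ubE : ubound E u.
  move=> _ [z + ->]; rewrite eigE => /orP[] /eqP ->; rewrite normcR //.
  by rewrite ger0_norm.
apply/eqP; rewrite eq_le; apply/andP; split.
  by apply: ge_sup => //; exists u.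
by apply: ub_le_sup => //; exists u.
Qed.

(** * Sums over words, and multiplicative weights of monomial matrices *)

Lemma sum_word_prod (R : nzRingType) (N n : nat) (A : 'I_N -> 'M[R]_2) :
  \sum_(w : {ffun 'I_n -> 'I_N}) word_prod A w = (\sum_i A i) ^+ n.
Proof.
(* Expanding the power gives products with the letters in index order, while [word_prod] multiplies
   them in reverse; reversal permutes the words. *)
pose rev_word (w : {ffun 'I_n -> 'I_N}) : {ffun 'I_n -> 'I_N} :=
  [ffun j => w (rev_ord j)].
have rev_wordK : involutive rev_word.
  by move=> w; apply/ffunP => j; rewrite !ffunE rev_ordK.
rewrite -[in RHS](card_ord n) -prodr_const bigA_distr_bigA /=.
rewrite (reindex_inj (inv_inj rev_wordK)); apply: eq_bigr => w _.
by apply: eq_bigr => j _; rewrite ffunE rev_ordK.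
Qed.

Definition monomial22 {R : nzRingType} (B : 'M[R]_2) : Prop :=
  exists x y : R, [/\ x != 0, y != 0 &
    B = mx22 x 0 0 y \/ B = mx22 0 x y 0].

Lemma monomial22_1 (R : nzRingType) : monomial22 (1 : 'M[R]_2).
Proof.
exists 1, 1; rewrite oner_eq0; split=> //; left.
by rewrite [LHS]mx22_eta !mxE.
Qed.

Lemma monomial22_mul (R : idomainType) (B C : 'M[R]_2) :
  monomial22 B -> monomial22 C -> monomial22 (B * C).
Proof.
move=> [x [y [x0 y0 BE]]] [x' [y' [x'0 y'0 CE]]].
case: BE CE => -> [] ->; rewrite -mulmxE mulmx22 !(mul0r, mulr0, add0r, addr0).
- by exists (x * x'), (y * y'); split; rewrite ?mulf_neq0 //; left.
- by exists (x * x'), (y * y'); split; rewrite ?mulf_neq0 //; right.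
- by exists (x * y'), (y * x'); split; rewrite ?mulf_neq0 //; right.
- by exists (x * y'), (y * x'); split; rewrite ?mulf_neq0 //; left.
Qed.

(** One formula covers both shapes. Since [0]^ 0 = 1[and]p[may be 0, the entries off the shape
    vanish only thanks to their factor]0 [^ t] with [t != 0]. *)
Definition weight_mx {R : realType} (t p : R) (B : 'M[R]_2) : 'M[R]_2 :=
  mx22 (`|B 0 0| `^ t * `|B 1 1| `^ p) (`|B 0 1| `^ t * `|B 1 0| `^ p)
       (`|B 0 1| `^ p * `|B 1 0| `^ t) (`|B 0 0| `^ p * `|B 1 1| `^ t).

Section WeightMx.
Context {R : realType} (t p : R).
Hypothesis t0 : t != 0.

Lemma weight_mx_diag (x y : R) :
  weight_mx t p (mx22 x 0 0 y) =
  mx22 (`|x| `^ t * `|y| `^ p) 0 0 (`|x| `^ p * `|y| `^ t).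
Proof. by rewrite /weight_mx !mxE /= normr0 powR0 // mul0r mulr0. Qed.

Lemma weight_mx_anti (x y : R) :
  weight_mx t p (mx22 0 x y 0) =
  mx22 0 (`|x| `^ t * `|y| `^ p) (`|x| `^ p * `|y| `^ t) 0.
Proof. by rewrite /weight_mx !mxE /= normr0 powR0 // mul0r mulr0. Qed.

Lemma weight_mx1 : weight_mx t p 1 = 1.
Proof.
rewrite [1 in LHS]mx22_eta [1 in RHS]mx22_eta !mxE /= weight_mx_diag.
by rewrite normr1 !powR1 mulr1.
Qed.

(** Each nonzero entry of a product of monomial matrices is a single product, never a sum, so
    absolute values and powers distribute over it. *)
Lemma weight_mxM (B C : 'M[R]_2) : monomial22 B -> monomial22 C ->
  weight_mx t p (B * C) = weight_mx t p B * weight_mx t p C.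
Proof.
move=> [x [y [_ _ BE]]] [x' [y' [_ _ CE]]]; rewrite -!mulmxE.
case: BE CE => -> [] ->; rewrite mulmx22 !(mul0r, mulr0, add0r, addr0);
  rewrite !(weight_mx_diag, weight_mx_anti) mulmx22;
  rewrite !(mul0r, mulr0, add0r, addr0) !normrM !powRM //;
  congr mx22; ring.
Qed.

Lemma monomial22_word_prod (N n : nat) (A : 'I_N -> 'M[R]_2)
    (w : {ffun 'I_n -> 'I_N}) : (forall i, monomial22 (A i)) ->
  monomial22 (word_prod A w) /\
  weight_mx t p (word_prod A w) = word_prod (weight_mx t p \o A) w.
Proof.
move=> monA; rewrite /word_prod.
apply: (big_ind2 (fun B B' => monomial22 B /\ weight_mx t p B = B')).
- by split; [exact: monomial22_1 | exact: weight_mx1].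
- move=> B B' C C' [mB <-] [mC <-]; split; first exact: monomial22_mul.
  exact: weight_mxM.
- by move=> j _; split.
Qed.

End WeightMx.

(** * Singular values compared with entry sums *)

Definition entry_sum {R : pzRingType} {m n : nat} (M : 'M[R]_(m, n)) : R :=
  \sum_i \sum_j M i j.

Lemma entry_sum_mx22 (R : pzRingType) (a b c d : R) :
  entry_sum (mx22 a b c d) = a + b + (c + d).
Proof. by rewrite /entry_sum !(big_ord_recl, big_ord0) !addr0 !mxE. Qed.

Lemma entry_sum_sum (R : pzRingType) (m n : nat) (I : finType)
    (F : I -> 'M[R]_(m, n)) :
  entry_sum (\sum_x F x) = \sum_x entry_sum (F x).
Proof.
rewrite /entry_sum [RHS]exchange_big; apply: eq_bigr => i _.
by rewrite [RHS]exchange_big; apply: eq_bigr => j _; rewrite summxE.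
Qed.

Lemma powR_max_min_bounds (R : realType) (t p x y : R) :
  p <= t -> 0 < x -> 0 < y ->
  (x `^ t * y `^ p + x `^ p * y `^ t) / 2 <=
    Num.max x y `^ t * Num.min x y `^ p <=
  x `^ t * y `^ p + x `^ p * y `^ t.
Proof.
move=> pt; wlog yx : x y / y <= x => [hwlog|] x0 y0.
  case/orP: (le_total y x) => [yx|xy]; first exact: hwlog.
  rewrite maxC minC addrC [x `^ t * _]mulrC [x `^ p * _]mulrC.
  exact: hwlog.
have powRt (z : R) : 0 < z -> z `^ t = z `^ p * z `^ (t - p).
  by move=> z0; rewrite -powRD ?subrKC // (gt_eqF z0) implybT.
(* After the common factor [x]^ p * y [^ p] is taken out, this is monotonicity of the power
   [t - p >= 0]. The larger term then lies between the mean and the sum. *)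
have le_swap : x `^ p * y `^ t <= x `^ t * y `^ p.
  rewrite (powRt _ x0) (powRt _ y0) mulrAC mulrA.
  rewrite ler_wpM2l ?mulr_ge0 ?powR_ge0 //.
  by apply: ge0_ler_powR; rewrite ?nnegrE ?subr_ge0 // ltW.
have h1 := mulr_ge0 (powR_ge0 x p) (powR_ge0 y t).
rewrite (max_l yx) (min_r yx); apply/andP; split; lra.
Qed.

Lemma alpha_weight_bounds (R : realType) (t p : R) (B : 'M[R]_2) :
  0 < t -> p <= t -> monomial22 B ->
  entry_sum (weight_mx t p B) / 2 <= alpha1 B `^ t * alpha2 B `^ p <=
  entry_sum (weight_mx t p B).
Proof.
move=> t0 pt [x [y [x0 y0 BE]]].
have t_neq0 : t != 0 by rewrite gt_eqF.
have eE : entry_sum (weight_mx t p B) = `|x| `^ t * `|y| `^ p + `|x| `^ p * `|y| `^ t.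
  case: BE => ->; rewrite (weight_mx_diag, weight_mx_anti) //.
    by rewrite entry_sum_mx22 addr0 add0r.
  by rewrite entry_sum_mx22 addr0 add0r.
have svE : alpha1 B = Num.max `|x| `|y| /\ alpha2 B = Num.min `|x| `|y|.
  rewrite /alpha1 /alpha2; case: BE => BE.
    by rewrite (@singular_values_diag_gram _ B x y) // BE trmx22 mulmx22
      !(mul0r, mulr0, add0r, addr0).
  (* In the antidiagonal case the Gram matrix is diagonal with entries [y ^+ 2], [x ^+ 2], hence the
     swap. *)
  rewrite (@singular_values_diag_gram _ B y x) ?[Num.max `|y| _]maxC
    ?[Num.min `|y| _]minC //.
  by rewrite BE trmx22 mulmx22 !(mul0r, mulr0, add0r, addr0).
by case: svE => -> ->; rewrite eE; apply: powR_max_min_bounds;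
  rewrite ?normr_gt0.
Qed.

(** * Growth of powers of nonnegative matrices, and n-th roots *)

Lemma mx_exp_ge0 (R : numDomainType) (m : nat) (M : 'M[R]_m.+1) (n : nat) :
  (forall i j, 0 <= M i j) -> forall i j, 0 <= (M ^+ n) i j.
Proof.
move=> M0; elim: n => [|n IHn] i j; first by rewrite expr0 mxE ler0n.
by rewrite exprS -mulmxE mxE sumr_ge0 // => l _; rewrite mulr_ge0.
Qed.

Lemma mx_exp_eigen (R : comNzRingType) (m : nat) (M : 'M[R]_m.+1)
    (v : 'cV[R]_m.+1) (l : R) (n : nat) :
  M *m v = l *: v -> M ^+ n *m v = l ^+ n *: v.
Proof.
move=> Mv; elim: n => [|n IHn]; first by rewrite !expr0 mul1mx scale1r.
by rewrite exprS -mulmxE -mulmxA IHn -scalemxAr Mv scalerA -exprSr.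
Qed.

(** Summing the coordinates of [M ^+ n *m v = l ^+ n *: v] gives the entries of [M ^+ n] weighted by
    those of [v]; bounding the weights by [lo] and [hi] leaves the plain entry sum. *)
Lemma entry_sum_exp_bounds (R : numFieldType) (m : nat) (M : 'M[R]_m.+1)
    (v : 'cV[R]_m.+1) (l lo hi : R) (n : nat) :
  (forall i j, 0 <= M i j) -> M *m v = l *: v ->
  0 < lo -> 0 < hi -> (forall i, lo <= v i 0 <= hi) ->
  (\sum_i v i 0) / hi * l ^+ n <= entry_sum (M ^+ n) <=
  (\sum_i v i 0) / lo * l ^+ n.
Proof.
move=> M0 Mv lo0 hi0 vb.
have sumE : (\sum_i v i 0) * l ^+ n = \sum_i \sum_j (M ^+ n) i j * v j 0.
  rewrite mulr_suml; apply: eq_bigr => i _; rewrite mulrC.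
  by have /matrixP/(_ i 0) := mx_exp_eigen _ _ _ _ _ n Mv; rewrite !mxE.
rewrite ![_ / _ * _]mulrAC ler_pdivrMr // ler_pdivlMr // sumE.
rewrite /entry_sum !mulr_suml; apply/andP; split; apply: ler_sum => i _;
  rewrite mulr_suml; apply: ler_sum => j _; rewrite ler_wpM2l ?mx_exp_ge0 //.
  by case/andP: (vb j).
by case/andP: (vb j).
Qed.

Lemma cvg_root_const (R : realType) (x : R) : 0 < x ->
  x `^ (n%:R^-1) @[n --> \oo] --> (1 : R).
Proof.
move=> x0; have -> : (fun n : nat => x `^ (n%:R^-1)) =
    (fun n : nat => expR (n%:R^-1 * ln x)).
  by apply/funext => n; rewrite /powR gt_eqF.
have invn0 : (n%:R^-1 : R) @[n --> \oo] --> (0 : R).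
  by rewrite -(cvg_shiftS (fun n => n%:R^-1 : R)); exact: cvg_harmonic.
rewrite -[X in _ --> X]expR0 -[X in _ --> expR X](mul0r (ln x)).
apply: continuous_cvg; first exact: continuous_expR.
exact: cvgMr_tmp.
Qed.

Lemma cvg_root_geometric (R : realType) (u : nat -> R) (l C1 C2 : R) :
  0 < l -> 0 < C1 -> 0 < C2 ->
  (forall n, C1 * l ^+ n <= u n <= C2 * l ^+ n) ->
  (u n) `^ (n%:R^-1) @[n --> \oo] --> l.
Proof.
move=> l0 C10 C20 ub.
have root_geom (C : R) : 0 < C ->
    (C * l ^+ n) `^ (n%:R^-1) @[n --> \oo] --> l.
  move=> C0; rewrite -[X in _ --> X]mul1r.
  have : C `^ (n%:R^-1) * l @[n --> \oo] --> 1 * l.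
    by apply: cvgMr_tmp; exact: cvg_root_const.
  apply: cvg_trans; apply: near_eq_cvg; near=> n.
  (* At [n = 0] the exponent is [0^-1 = 0] and the two sequences may differ, so they agree only
     eventually. *)
  have n0 : (0 < n)%N by near: n; exists 1%N.
  rewrite powRM ?ltW ?exprn_gt0 // -powR_mulrn ?ltW // -powRrM.
  by rewrite divff ?pnatr_eq0 -?lt0n // powRr1 ?ltW.
apply: (@squeeze_cvgr _ _ _ _ _ _ _ _ _ (root_geom C1 C10) (root_geom C2 C20)).
near=> n; case/andP: (ub n) => lb {}ub.
have lC0 : 0 <= C1 * l ^+ n by rewrite mulr_ge0 ?exprn_ge0 ?ltW.
have u0 := le_trans lC0 lb.
by apply/andP; split; apply: ge0_ler_powR; rewrite ?nnegrE ?invr_ge0 ?ler0n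
  ?(le_trans u0 ub).
Unshelve. all: by end_near. Qed.

(* When q, r > 0, (q, l - p) is a positive eigenvector for the larger root l of
   the characteristic polynomial. *)
Lemma perron22_growth (R : realType) (p q r s : R) :
  0 <= p -> 0 < q -> 0 < r -> 0 <= s ->
  let M := mx22 p q r s in
  exists C1 C2, [/\ 0 < spectral_radius M, 0 < C1, 0 < C2 &
    forall n, C1 * spectral_radius M ^+ n <= entry_sum (M ^+ n) <=
              C2 * spectral_radius M ^+ n].
Proof.
move=> p0 q0 r0 s0 M.
(* The discriminant of the characteristic polynomial: [(p + s) ^+ 2 - 4 * (p * s - q * r)]. *)
pose D := Num.sqrt ((p - s) ^+ 2 + 4 * (q * r)).
have qr0 := mulr_gt0 q0 r0.
have sq0 := sqr_ge0 (p - s).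
have DD : D ^+ 2 = (p - s) ^+ 2 + 4 * (q * r) by rewrite sqr_sqrtr //; lra.
have D0 : 0 <= D by rewrite sqrtr_ge0.
have Dps : `|p - s| < D.
  by rewrite -(@ltr_pXn2r _ 2) ?nnegrE // real_normK ?num_real // DD; lra.
pose l := (p + s + D) / 2.
(* The strict bound [p < l] is what makes the second coordinate of the eigenvector positive. *)
have [lp ls] : p < l /\ s < l.
  by move: Dps; rewrite ltr_norml => /andP[? ?]; rewrite /l; split; lra.
have charE : (l - p) * (l - s) = q * r.
  have -> : q * r = (D ^+ 2 - (p - s) ^+ 2) / 4 by rewrite DD; field.
  by rewrite /l; field.
have rhoE : spectral_radius M = l.
  (* The other root is the trace minus [l]; its modulus is at most [l] because [p + s] and [D] are
     nonnegative. *)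
  apply: (@spectral_radius_split _ _ _ (p + s - l)).
    rewrite char_poly_mx22 -polyCM -charE.
    by rewrite !(polyCD, polyCN, polyCM); ring.
  rewrite ler_norml; apply/andP; split; rewrite /l; lra.
rewrite rhoE.
pose v : 'cV[R]_2 := \col_i if i == 0 then q else l - p.
have Mv : M *m v = l *: v.
  apply/matrixP => i j; rewrite !mxE big_ord_recl big_ord1 !mxE /=.
  case: (ord2P i) => -> /=; first ring.
  by rewrite [r * q]mulrC -charE; ring.
have lo0 : 0 < Num.min q (l - p) by rewrite lt_min q0 subr_gt0.
have hi0 : 0 < Num.max q (l - p) by rewrite lt_max q0.
have sv0 : 0 < \sum_i v i 0.
  by rewrite big_ord_recl big_ord1 !mxE /= addr_gt0 ?subr_gt0.
exists ((\sum_i v i 0) / Num.max q (l - p)), ((\sum_i v i 0) / Num.min q (l - p)).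
split; [lra | exact: divr_gt0 | exact: divr_gt0 | move=> n].
apply: entry_sum_exp_bounds => // [i j|i].
- by rewrite mxE; case: (ord2P i) => ->; case: (ord2P j) => -> //=; exact: ltW.
- by rewrite mxE; case: ifP => _; rewrite ge_min le_max !lexx ?orbT.
Qed.

(** For [p != s] a diagonal matrix has no positive eigenvector, so its powers are computed
    directly. *)
Lemma diag22_growth (R : realType) (p s : R) :
  0 < p -> 0 < s ->
  let M := mx22 p 0 0 s in
  exists C1 C2, [/\ 0 < spectral_radius M, 0 < C1, 0 < C2 &
    forall n, C1 * spectral_radius M ^+ n <= entry_sum (M ^+ n) <=
              C2 * spectral_radius M ^+ n].
Proof.
move=> p0 s0 M.
have MnE n : M ^+ n = mx22 (p ^+ n) 0 0 (s ^+ n).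
  elim: n => [|n IHn]; first by rewrite !expr0 [LHS]mx22_eta !mxE.
  by rewrite exprS IHn -mulmxE mulmx22 !(mul0r, mulr0, add0r, addr0) -!exprS.
have cpE : char_poly M = ('X - p%:P) * ('X - s%:P).
  by rewrite char_poly_mx22 mul0r subr0.
have rhoE : spectral_radius M = Num.max p s.
  have [ps|/ltW sp] := lerP p s.
    rewrite mulrC in cpE; apply: (spectral_radius_split _ _ _ _ cpE).
    by rewrite ger0_norm // ltW.
  by apply: (spectral_radius_split _ _ _ _ cpE); rewrite ger0_norm // ltW.
(* The sum of two positive numbers lies between their maximum and twice it. *)
exists 1, 2; rewrite rhoE; split=> // [|n]; first by rewrite lt_max p0.
rewrite MnE entry_sum_mx22 addr0 add0r mul1r.
have pn := exprn_gt0 n p0; have sn := exprn_gt0 n s0.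
have [ps|/ltW sp] := lerP p s.
  have := lerXn2r n (ltW p0 : p \in Num.nneg) (ltW s0 : s \in Num.nneg) ps.
  by move=> h; apply/andP; split; lra.
have := lerXn2r n (ltW s0 : s \in Num.nneg) (ltW p0 : p \in Num.nneg) sp.
by move=> h; apply/andP; split; lra.
Qed.

(** * The sum over words compared with powers of the weight matrix *)

Theorem proposition5 (R : realType) (N : nat) (hN : (1 <= N)%N)
    (A : 'I_N -> 'M[R]_2) (s t : R)
    (ht0 : 0 < t) (ht1 : t <= 1) (hts : t <= s) (hst : s <= 2 * t)
    (k : nat) (hk : (k <= N)%N) (a b c d : 'I_N -> R)
    (hdiag : forall i : 'I_N, (i < k)%N ->
       [/\ A i = mx22 (a i) 0 0 (d i), a i != 0 & d i != 0])
    (hanti : forall i : 'I_N, (k <= i)%N ->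
       [/\ A i = mx22 0 (b i) (c i) 0, b i != 0 & c i != 0]) :
  (\sum_(w : {ffun 'I_n -> 'I_N})
      alpha1 (word_prod A w) `^ t * alpha2 (word_prod A w) `^ (s - t))
    `^ (n%:R^-1) @[n --> \oo] -->
  spectral_radius
    (mx22 (\sum_(i < N | (i < k)%N) `|a i| `^ t * `|d i| `^ (s - t))
          (\sum_(i < N | (k <= i)%N) `|b i| `^ t * `|c i| `^ (s - t))
          (\sum_(i < N | (k <= i)%N) `|b i| `^ (s - t) * `|c i| `^ t)
          (\sum_(i < N | (i < k)%N) `|a i| `^ (s - t) * `|d i| `^ t)).
Proof.
set M := mx22 _ _ _ _.
have t_neq0 : t != 0 by rewrite gt_eqF.
have monA i : monomial22 (A i).
  have [ik|ki] := ltnP i k.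
    by have [AE ? ?] := hdiag _ ik; exists (a i), (d i); split=> //; left.
  by have [AE ? ?] := hanti _ ki; exists (b i), (c i); split=> //; right.
have ME : \sum_i weight_mx t (s - t) (A i) = M.
  rewrite (bigID (fun i : 'I_N => (i < k)%N)) /=.
  rewrite (eq_bigr (fun i => mx22 (`|a i| `^ t * `|d i| `^ (s - t)) 0 0
      (`|a i| `^ (s - t) * `|d i| `^ t))); last first.
    by move=> i /hdiag[-> _ _]; rewrite weight_mx_diag.
  rewrite mx22_sum [X in _ + X](eq_big (fun i : 'I_N => (k <= i)%N)
      (fun i => mx22 0 (`|b i| `^ t * `|c i| `^ (s - t))
      (`|b i| `^ (s - t) * `|c i| `^ t) 0)); last first.
  - by move=> i; rewrite -leqNgt => /hanti[-> _ _]; rewrite weight_mx_anti.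
  - by move=> i; rewrite -leqNgt.
  rewrite mx22_sum !big1_eq; apply/matrixP => i j; rewrite !mxE.
  by case: (ord2P i) => ->; case: (ord2P j) => -> /=; rewrite ?addr0 ?add0r.
have sum_gt0 (P : pred 'I_N) (i0 : 'I_N) (F : 'I_N -> R) : P i0 ->
    (forall i, P i -> 0 < F i) -> 0 < \sum_(i | P i) F i.
  move=> Pi0 F0; rewrite (bigD1 i0) //= ltr_wpDr ?F0 // sumr_ge0 // => i.
  by move=> /andP[/F0/ltW].
have wgt_gt0 (x y p q : R) : x != 0 -> y != 0 -> 0 < `|x| `^ p * `|y| `^ q.
  by move=> x0 y0; rewrite mulr_gt0 ?powR_gt0 ?normr_gt0.
have wgt_ge0 (P : pred 'I_N) (x y : 'I_N -> R) (p q : R) :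
    0 <= \sum_(i | P i) `|x i| `^ p * `|y i| `^ q.
  by rewrite sumr_ge0 // => i _; rewrite mulr_ge0 ?powR_ge0.
have [C1 [C2 [rho0 C10 C20 Mn]]] : exists C1 C2,
    [/\ 0 < spectral_radius M, 0 < C1, 0 < C2 &
    forall n, C1 * spectral_radius M ^+ n <= entry_sum (M ^+ n) <=
              C2 * spectral_radius M ^+ n].
  (* If [k < N], some letter is antidiagonal and both off-diagonal sums are positive. Otherwise
     these sums are empty, and [N >= 1] makes the diagonal sums positive. *)
  have [kN|Nk] := ltnP k N.
    apply: perron22_growth => //; apply: (sum_gt0 _ (Ordinal kN)) => //= i;
      by move=> /hanti[_ b0 c0]; exact: wgt_gt0.
  rewrite /M [X in mx22 _ X]big_pred0 => [|i]; last first.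
    by apply/negbTE; rewrite -ltnNge (leq_trans _ Nk).
  rewrite [X in mx22 _ _ X]big_pred0 => [|i]; last first.
    by apply/negbTE; rewrite -ltnNge (leq_trans _ Nk).
  by apply: diag22_growth; apply: (sum_gt0 _ (Ordinal hN)) => [|i /hdiag[_ a0 d0]];
    rewrite /= ?(leq_trans hN Nk) ?wgt_gt0.
(* The halved constant absorbs the factor 2 lost in [alpha_weight_bounds]. *)
apply: (@cvg_root_geometric _ _ _ (C1 / 2) C2) => //; first exact: divr_gt0.
move=> n; have [lb ub] := andP (Mn n).
(* Expanding [M ^+ n] over words and using multiplicativity of the weight moves the weight outside
   each word product. *)
have sumE : entry_sum (M ^+ n) = \sum_(w : {ffun 'I_n -> 'I_N})
    entry_sum (weight_mx t (s - t) (word_prod A w)).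
  rewrite -ME -sum_word_prod entry_sum_sum; apply: eq_bigr => w _.
  by have [_ ->] := monomial22_word_prod t (s - t) t_neq0 _ _ _ w monA.
have pt : s - t <= t by lra.
have wb (w : {ffun 'I_n -> 'I_N}) := alpha_weight_bounds _ _ _ _ ht0 pt
  (monomial22_word_prod t (s - t) t_neq0 _ _ _ w monA).1.
apply/andP; split.
  rewrite mulrAC (@le_trans _ _ (entry_sum (M ^+ n) / 2)) //.
    by rewrite ler_pM2r // invr_gt0.
  rewrite sumE mulr_suml; apply: ler_sum => w _.
  by have /andP[] := wb w.
rewrite (le_trans _ ub) // sumE; apply: ler_sum => w _.
by have /andP[] := wb w.
Qed.
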